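(* Let $F$ be a tame Fréchet space and let $V\cong W$ be isomorphic Banach spaces. Let $U\subset F\times V$ be open and let $\varphi:U\to W$, $(x,y)\mapsto\varphi(x,y)$, be a smooth tame map. Let $z_0=(x_0,y_0)\in U$ be such that $\varphi(z_0)=0$ and the partial derivative $\frac{\partial}{\partial y}\varphi(z_0):V\to W$ is invertible. Then there exist open subsets $U'\subset F$ with $x_0\in U'$ and $U''\subset V$ with $y_0\in U''$, with $U'\times U''\subset U$, and a smooth tame map $\psi:U'\to U''$ such that for all $(x,y)\in U'\times U''$ $$\varphi(x,y)=0\iff y=\psi(x).$$
   Context: A Fréchet space is a complete, Hausdorff, metrizable locally convex topological vector space. A grading on it is a sequence of seminorms $\|\cdot\|_0\le\|\cdot\|_1\le\|\cdot\|_2\le\dots$ defining the topology; a graded Fréchet space is one with a chosen grading. A Banach space is graded by taking all $\|\cdot\|_n$ equal to its norm; a finite product is graded by the sum of the seminorms. A linear map $L:F\to G$ of graded Fréchet spaces is tame if there are $r,b\in\mathbb N_0$ and constants $C(n)>0$ with $\|L f\|_n\le C(n)\|f\|_{n+r}$ for all $n\ge b$ and all $f$. $F$ is a tame direct summand of $G$ if there are tame linear maps $F\to G\to F$ whose composition is the identity of $F$. For a Banach space $E$, $\Sigma(E)$ is the space of sequences $(f_k)_{k\ge0}$ in $E$ with $\sum_k e^{nk}\|f_k\|<\infty$ for all $n$, graded by $\|f\|_n=\sum_k e^{nk}\|f_k\|$. A tame Fréchet space is a graded Fréchet space that is a tame direct summand of $\Sigma(E)$ for some Banach space $E$. A (nonlinear)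 map $\Phi:U\subset F\to G$ is tame if there are $r,b\in\mathbb N_0$ and $C(n)>0$ with $\|\Phi(f)\|_n\le C(n)(1+\|f\|_{n+r})$ for all $n>b$ and $f\in U$. A smooth tame map is a smooth map (all directional derivatives $D^k\Phi(f)\{h_1,\dots,h_k\}$ exist and are jointly continuous) that is tame. *)

(* Defs.v *)
From HB Require Import structures.
From mathcomp Require Import all_boot all_order all_algebra.
From mathcomp Require Import all_classical all_reals all_analysis.

Set Implicit Arguments.
Unset Strict Implicit.
Unset Printing Implicit Defensive.

Import Order.TTheory GRing.Theory Num.Theory.
Import numFieldNormedType.Exports.

Local Open Scope classical_set_scope.
Local Open Scope ring_scope.

(* tvsType is the library's locally convex topological vector space.  Its
   uniform structure is not required to be the translation-invariant one, so
   completeness is expressed through differences rather than through the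
   library's cauchy. *)
Definition tvs_cauchy (R : realType) (E : tvsType R) (A : set_system E) : Prop :=
  (fun z : E * E => z.1 - z.2) @ filter_prod A A --> (0 : E).

Definition tvs_complete (R : realType) (E : tvsType R) : Prop :=
  forall A : set_system E, ProperFilter A -> tvs_cauchy A ->
    exists x : E, A --> x.

Definition metrizable (R : realType) (T : topologicalType) : Prop :=
  exists d : T -> T -> R,
    [/\ forall x y, d x y = 0 <-> x = y,
        forall x y, d x y = d y x,
        forall x y z, d x z <= d x y + d y z &
        forall x (A : set T), nbhs x A <->
          exists2 e : R, 0 < e & [set y | d x y < e] `<=` A].

Definition frechet (R : realType) (F : tvsType R) : Prop :=
  [/\ tvs_complete F, hausdorff_space F & metrizable R F].

Definition is_seminorm (R : realType) (E : lmodType R) (p : E -> R) : Prop :=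
  (forall x y, p (x + y) <= p x + p y) /\
  (forall (a : R) x, p (a *: x) = `|a| * p x).

(* The seminorms are increasing, so the balls of the single seminorms already
   form a neighbourhood basis of the topology they define. *)
Record is_grading (R : realType) (F : tvsType R) (p : nat -> F -> R) : Prop := {
  grading_seminorm : forall n, is_seminorm (p n);
  grading_le : forall n x, p n x <= p n.+1 x;
  grading_nbhs : forall x (A : set F), nbhs x A <->
    exists n, exists2 e : R, 0 < e & [set y | p n (y - x) < e] `<=` A }.

Definition norm_grading (R : realType) (E : normedModType R) :
  nat -> E -> R := fun _ x => `|x|.

Definition prod_grading (R : realType) (E F : lmodType R)
  (p : nat -> E -> R) (q : nat -> F -> R) : nat -> E * F -> R :=
  fun n z => p n z.1 + q n z.2.

Definition tame_linear (R : realType) (E F : lmodType R)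
  (p : nat -> E -> R) (q : nat -> F -> R) (L : {linear E -> F}) : Prop :=
  exists r b : nat, exists2 C : nat -> R, (forall n, 0 < C n) &
    forall n, (b <= n)%N -> forall x, q n (L x) <= C n * p (n + r)%N x.

Definition tame_direct_summand (R : realType) (E F : lmodType R)
  (p : nat -> E -> R) (q : nat -> F -> R) : Prop :=
  exists (L : {linear E -> F}) (M : {linear F -> E}),
    [/\ tame_linear p q L, tame_linear q p M & cancel L M].

Definition sigma_terms (R : realType) (E : normedModType R) (n : nat)
  (f : nat -> E) : nat -> R := fun k => expR (n * k)%:R * `|f k|.

Definition sigma_pred (R : realType) (E : normedModType R) : {pred nat -> E} :=
  fun f => `[< forall n, cvgn (series (sigma_terms n f)) >].

Section SigmaSpace.
Context (R : realType) (E : normedModType R).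

Lemma sigma_pred_submod_closed : submod_closed (@sigma_pred R E).
Proof.
split=> [|a f g /asboolP sf /asboolP sg]; apply/asboolP => n.
  have -> : sigma_terms n (0 : nat -> E) = fun=> 0.
    by apply/funext => k; rewrite /sigma_terms normr0 mulr0.
  rewrite (_ : series _ = fun=> 0); first exact: is_cvg_cst.
  by apply/funext => k; rewrite /series /= big1.
have sD : cvgn (series (`|a| *: sigma_terms n f + sigma_terms n g)).
  by apply: is_cvg_seriesD => //; apply: is_cvg_seriesZ.
apply: (series_le_cvg _ _ _ sD) => k; rewrite /sigma_terms.
- by rewrite mulr_ge0 ?expR_ge0.
- by rewrite addr_ge0 ?mulr_ge0 ?expR_ge0.
rewrite /= [leRHS](_ : _ = `|a| * (expR (n * k)%:R * `|f k|)
  + expR (n * k)%:R * `|g k|)//.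
rewrite mulrCA -mulrDr ler_wpM2l ?expR_ge0 //.
by rewrite -normrZ ler_normD.
Qed.

HB.instance Definition _ :=
  GRing.isSubmodClosed.Build R (nat -> E) (@sigma_pred R E)
    sigma_pred_submod_closed.

Record sigma_space := SigmaSpace {
  sigma_seq :> nat -> E;
  sigma_seqP : sigma_seq \in @sigma_pred R E }.

HB.instance Definition _ := [isSub for sigma_seq].
HB.instance Definition _ := gen_eqMixin sigma_space.
HB.instance Definition _ := gen_choiceMixin sigma_space.
HB.instance Definition _ := [SubChoice_isSubLmodule of sigma_space by <:].

Definition sigma_grading : nat -> sigma_space -> R :=
  fun n f => limn (series (sigma_terms n f)).

End SigmaSpace.

Record tame_frechet (R : realType) (F : tvsType R) (p : nat -> F -> R) :
    Prop := {
  tame_is_frechet : frechet F;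
  tame_is_grading : is_grading p;
  tame_summand : exists E : completeNormedModType R,
    tame_direct_summand p (@sigma_grading R E) }.

Section SmoothTame.
Context (R : realType) (F G : tvsType R).

(* [derive] and [derivable] of the library are restricted to normed modules;
   these are the same definitions over a topological vector space.  The value
   of [dir_derive] is 0 when the limit does not exist. *)
Definition dir_quotient (f : F -> G) (x v : F) : R -> G :=
  fun t => t^-1 *: (f (x + t *: v) - f x).

Definition dir_derivable (f : F -> G) (x v : F) : Prop :=
  exists l : G, dir_quotient f x v t @[t --> 0^'] --> l.

Definition dir_derive (f : F -> G) (x v : F) : G :=
  xget 0 [set l : G | dir_quotient f x v t @[t --> 0^'] --> l].

(* D^k f (x) {h_0, ..., h_(k-1)}; the last direction is differentiated last. *)
Fixpoint nderive (f : F -> G) (k : nat) : F -> ('I_k -> F) -> G :=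
  match k with
  | 0 => fun x _ => f x
  | k'.+1 => fun x h =>
      dir_derive (fun y => nderive f y (fun i => h (widen_ord (leqnSn k') i)))
        x (h ord_max)
  end.

(* For open U.  [f] is a total function, but on an open U the condition only
   depends on its restriction to U. *)
Definition smooth_on (U : set F) (f : F -> G) : Prop :=
  forall k,
    (forall x (h : 'I_k -> F) (v : F), U x ->
       dir_derivable (fun y => nderive f y h) x v) /\
    {within U `*` setT, continuous
       (fun z : F * {ptws 'I_k -> F} => nderive f z.1 z.2)}.

Definition tame_on (p : nat -> F -> R) (q : nat -> G -> R) (U : set F)
    (f : F -> G) : Prop :=
  exists r b : nat, exists2 C : nat -> R, (forall n, 0 < C n) &
    forall n, (b < n)%N -> forall x, U x ->
      q n (f x) <= C n * (1 + p (n + r)%N x).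

Definition smooth_tame_on (p : nat -> F -> R) (q : nat -> G -> R)
    (U : set F) (f : F -> G) : Prop :=
  smooth_on U f /\ tame_on p q U f.

End SmoothTame.

Definition tvs_isomorphic (R : realType) (V W : tvsType R) : Prop :=
  exists (T : {linear V -> W}) (S : {linear W -> V}),
    [/\ continuous T, continuous S, cancel T S & cancel S T].

(* Main.v *)
Require Import Defs.
From HB Require Import structures.
From mathcomp Require Import all_boot all_order all_algebra.
From mathcomp Require Import all_classical all_reals all_analysis.
From mathcomp Require Import ring lra.

Set Implicit Arguments.
Unset Strict Implicit.
Unset Printing Implicit Defensive.

Import Order.TTheory GRing.Theory Num.Theory.
Import numFieldNormedType.Exports.

Local Open Scope classical_set_scope.
Local Open Scope ring_scope.

(* Only local boundedness is needed, so no Nash-Moser iteration.  The second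
   derivative of [phi] is bilinear and jointly continuous, hence bounded near
   [(z0, 0, 0)]; therefore the partial derivative of [phi] along the Banach
   space [V] is continuous at [z0] for the operator norm.  Its inverse at [z0]
   is bounded by Baire's theorem, so for [x] near [x0] the contraction principle
   solves [phi (x, y) = 0] for [y] near [y0], and likewise inverts the partial
   derivative at the points [(x, psi x)].  The solution map is Lipschitz in the
   value of [phi], which gives its continuity and its first derivative.  Higher
   derivatives exist because the maps built from [psi], the derivatives of [phi]
   and the inverse of the partial derivative are continuous and form a class
   stable under differentiation.  Tameness of [psi] is immediate: its values stay
   in a ball. *)

(** * Mean value inequality and difference quotients *)

(** Differentiability gives the slope bound [M + e] near each point. The supremum [m] of the initial
    segments on which this bound holds is attained and cannot lie below [1]; then [e] is
    arbitrary. *)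
Lemma mean_value_ineq (R : realType) (W : normedModType R) (c dc : R -> W)
    (M : R) :
  (forall s, 0 <= s <= 1 -> t^-1 *: (c (s + t) - c s) @[t --> 0^'] --> dc s) ->
  (forall s, 0 <= s <= 1 -> `|dc s| <= M) -> `|c 1 - c 0| <= M.
Proof.
move=> cd dcM; apply/ler_addgt0Pr => e e0; set K := M + e.
have loc s : 0 <= s <= 1 -> exists2 d : R, 0 < d &
    forall t, `|t| < d -> `|c (s + t) - c s| <= K * `|t|.
  move=> s01; have /cvgrPdist_lt/(_ _ e0) := cd _ s01.
  move=> [d /= d0 H]; exists d => // t td.
  have [->|t0] := eqVneq t 0; first by rewrite addr0 subrr !normr0 mulr0.
  have {H} := H t; rewrite /= sub0r normrN => /(_ td t0) /ltW H.
  rewrite -(scale1r (c _ - _)) -(mulfV t0) -scalerA normrZ mulrC.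
  rewrite ler_wpM2r// /K -[X in `|X|](subrK (dc s)).
  rewrite (le_trans (ler_normD _ _))// addrC lerD// ?dcM// distrC.
  by [].
pose S := [set s : R | 0 <= s <= 1 /\
  forall r, 0 <= r <= s -> `|c r - c 0| <= K * r].
have S0 : S 0.
  split=> [|r /andP[r0 r1]]; first by rewrite lexx ler01.
  have -> : r = 0 by apply/eqP; rewrite eq_le r0 r1.
  by rewrite subrr normr0 mulr0.
have supS : has_sup S.
  by split; [exists 0|exists 1 => s [/andP[]]].
pose m := sup S.
have m0 : 0 <= m by apply: ub_le_sup => //; case: supS.
have m1 : m <= 1 by apply: ge_sup => [|s [/andP[]]//]; exists 0.
have m01 : 0 <= m <= 1 by rewrite m0 m1.
have ltm r : 0 <= r < m -> `|c r - c 0| <= K * r.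
  move=> /andP[r0 rm]; have mr0 : 0 < m - r by rewrite subr_gt0.
  have [s [_ Ss] ms] := sup_adherent mr0 supS.
  by apply: Ss; rewrite r0 ltW//; move: ms; rewrite -/m opprB addrC subrK.
have [d d0 md] := loc _ m01.
have Sm r : 0 <= r <= m -> `|c r - c 0| <= K * r.
  move=> /andP[r0]; rewrite le_eqVlt => /orP[/eqP ->|rm]; last first.
    by apply: ltm; rewrite r0.
  have [->|mn0] := eqVneq m 0; first by rewrite subrr normr0 mulr0.
  have mp : 0 < m by rewrite lt_neqAle eq_sym mn0.
  (* A step back from [m] shorter than [d] lands where the bound is known, and the local bound at
     [m] covers the rest. *)
  pose t := Num.min d m / 2.
  have t0 : 0 < t by rewrite divr_gt0// lt_min d0.
  have [td tm] : t < d /\ t < m.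
    have : Num.min d m / 2 < Num.min d m.
      by rewrite ltr_pdivrMr// ltr_pMr ?ltr1n// lt_min d0.
    by rewrite -/t lt_min => /andP.
  have := md (- t); rewrite normrN gtr0_norm// => /(_ td) A.
  have B : `|c (m - t) - c 0| <= K * (m - t) by apply: ltm; lra.
  rewrite -[c m](subrK (c (m - t))) -addrA (le_trans (ler_normD _ _))//.
  by rewrite distrC; lra.
have [m1E|mn1] := eqVneq m 1.
  by have := Sm 1; rewrite mulr1; apply; rewrite m1E lexx ler01.
have mlt1 : m < 1 by rewrite lt_neqAle mn1.
pose t := Num.min d (1 - m) / 2.
have t0 : 0 < t by rewrite divr_gt0// lt_min d0 subr_gt0.
have [td tm] : t < d /\ t < 1 - m.
  have : Num.min d (1 - m) / 2 < Num.min d (1 - m).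
    by rewrite ltr_pdivrMr// ltr_pMr ?ltr1n// lt_min d0 subr_gt0.
  by rewrite -/t lt_min => /andP.
suff : S (m + t).
  by move=> /(ub_le_sup supS.2); rewrite -/m; lra.
split=> [|r /andP[r0 rmt]]; first by lra.
have [rm|mr] := leP r m; first by apply: Sm; rewrite r0.
have /(_ (r - m)) := md; rewrite gtr0_norm ?subr_gt0// [m + _]addrC subrK => A.
have {}A : `|c r - c m| <= K * (r - m) by apply: A; lra.
have B : `|c m - c 0| <= K * m by apply: Sm; lra.
rewrite -[c r](subrK (c m)) -addrA (le_trans (ler_normD _ _))//.
by lra.
Qed.

Section TvsLimits.
Context (R : realType) (E : tvsType R) (T : Type) (FF : set_system T).
Context {FFF : Filter FF}.

Lemma tvs_cvgD (f g : T -> E) (a b : E) :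
  f @ FF --> a -> g @ FF --> b -> (f t + g t) @[t --> FF] --> a + b.
Proof.
by move=> fa ga; exact: (continuous2_cvg _ (add_continuous (a, b)) fa ga).
Qed.

Lemma tvs_cvgN (f : T -> E) (a : E) :
  f @ FF --> a -> - f t @[t --> FF] --> - a.
Proof. by move=> fa; exact: (cvg_comp _ _ fa (opp_continuous a)). Qed.

Lemma tvs_cvgZ (s : T -> R) (f : T -> E) (k : R) (a : E) :
  s @ FF --> k -> f @ FF --> a -> (s t *: f t) @[t --> FF] --> k *: a.
Proof.
move=> sk fa; exact: (@continuous2_cvg _ R^o _ _ _ _ _ _ (fun x y => x *: y)
  _ _ (@scale_continuous _ _ (k, a)) sk fa).
Qed.

End TvsLimits.

Lemma cvg_dnbhs0_mulr (R : realType) (a : R) : a != 0 ->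
  t * a @[t --> 0^'] --> 0^'.
Proof.
move=> a0 A [e /= e0 H]; exists (e / `|a|).
  by rewrite /= divr_gt0// normr_gt0.
move=> t /= ta t0; apply: H; last by rewrite mulf_neq0.
by move: ta => /=; rewrite !sub0r !normrN normrM -ltr_pdivlMr ?normr_gt0.
Qed.

Section Curves.
Context (R : realType) (E : tvsType R).

Lemma cvg_id_dnbhs0 : t @[t --> (0 : R)^'] --> (0 : R).
Proof. exact: nbhs_dnbhs. Qed.

Lemma cvg_line (z v : E) : (z + t *: v) @[t --> (0 : R)^'] --> z.
Proof.
rewrite -[X in _ --> nbhs X]addr0 -[X in z + X](scale0r v).
apply: tvs_cvgD; first exact: cvg_cst.
by apply: tvs_cvgZ; [exact: cvg_id_dnbhs0|exact: cvg_cst].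
Qed.

Lemma cvg_difference_quotient (c : R -> E) (z v : E) :
  t^-1 *: (c t - z) @[t --> 0^'] --> v -> c t @[t --> 0^'] --> z.
Proof.
move=> cv; rewrite -[X in _ --> nbhs X]addr0 -[X in z + X](scale0r v).
have cz : z @[t --> (0 : R)^'] --> z by exact: cvg_cst.
apply: cvg_trans (tvs_cvgD cz (tvs_cvgZ cvg_id_dnbhs0 cv)).
apply: near_eq_cvg; near=> t.
have t0 : t != 0 by near: t; exact: nbhs_dnbhs_neq.
by rewrite scalerA mulfV// scale1r addrC subrK.
Unshelve. all: by end_near. Qed.

End Curves.

(** The mean value inequality is applied to the curve with [s *: l] subtracted, whose derivative is
    [dg s - l]. *)
Lemma mean_value_line (R : realType) (E : tvsType R) (W : normedModType R)
    (g : E -> W) (dg : R -> W) (z u : E) (l : W) (e : R) :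
  (forall s, 0 <= s <= 1 -> dir_quotient g (z + s *: u) u t @[t --> 0^'] --> dg s) ->
  (forall s, 0 <= s <= 1 -> `|dg s - l| <= e) -> `|g (z + u) - g z - l| <= e.
Proof.
move=> gd dgl; pose c s := g (z + s *: u) - s *: l.
rewrite (_ : _ - l = c 1 - c 0); last first.
  by rewrite /c !scale1r !scale0r subr0 addr0 addrAC.
apply: (@mean_value_ineq _ _ c (fun s => dg s - l)) => // s s01.
have cl : l @[t --> (0 : R)^'] --> l by exact: cvg_cst.
apply: cvg_trans (cvgB (gd s s01) cl); apply: near_eq_cvg; near=> t.
have t0 : t != 0 by near: t; exact: nbhs_dnbhs_neq.
have -> : c (s + t) - c s = (g (z + s *: u + t *: u) - g (z + s *: u)) - t *: l.
  rewrite /c !scalerDl addrA opprB [s *: l - _]addrC addrACA; congr (_ + _).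
  by rewrite opprD addrAC addNr add0r.
by rewrite [RHS]scalerBr scalerA mulVf// scale1r.
Unshelve. all: by end_near. Qed.

Section Hadamard.
Context (R : realType) (E : tvsType R) (W : normedModType R) (U : set E).
Context (g : E -> W) (dg : E -> E -> W).
Hypothesis oU : open U.
Hypothesis gd : forall z v, U z -> dir_quotient g z v t @[t --> 0^'] --> dg z v.
Hypothesis gc : forall z v, U z -> dg p.1 p.2 @[p --> (z, v)] --> dg z v.

(** Base point, direction and step size may all vary with [t]. Joint continuity keeps [dg] close to
    [dg z0 v0] on the whole short segment from [zt t], and the mean value inequality transfers this
    to the quotient. *)
Lemma C1_difference_quotient (T : Type) (FF : set_system T) {FFF : Filter FF}
    (zt vt : T -> E) (tau : T -> R) (z0 v0 : E) :
  U z0 -> zt @ FF --> z0 -> vt @ FF --> v0 -> tau @ FF --> (0 : R) ->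
  (\forall t \near FF, tau t != 0) ->
  (tau t)^-1 *: (g (zt t + tau t *: vt t) - g (zt t)) @[t --> FF] --> dg z0 v0.
Proof.
move=> Uz0 cz cv ct tn0; apply/cvgrPdist_le => e e0.
pose N := [set p : E * E | `|dg z0 v0 - dg p.1 p.2| <= e /\ U p.1].
have nN : nbhs (z0, v0) N.
  apply: filterI; first by move/cvgrPdist_le: (gc (v := v0) Uz0) => /(_ _ e0).
  have : fst p @[p --> (z0, v0)] --> z0 by exact: cvg_fst.
  by apply; exact: open_nbhs_nbhs.
(* Continuity of [h] at [(0, (z0, v0))] keeps all points of the segment in [N] at once, uniformly in
   the parameter [s]. *)
pose h (q : R^o * (E * E)) := (q.2.1 + q.1 *: q.2.2, q.2.2).
have : h @ nbhs ((0 : R^o), (z0, v0)) --> (z0, v0).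
  have c2 : snd @ nbhs ((0 : R^o), (z0, v0)) --> (z0, v0) by exact: cvg_snd.
  have c21 : (fst \o snd) @ nbhs ((0 : R^o), (z0, v0)) --> z0.
    by apply: (cvg_comp _ _ c2); exact: cvg_fst.
  have c22 : (snd \o snd) @ nbhs ((0 : R^o), (z0, v0)) --> v0.
    by apply: (cvg_comp _ _ c2); exact: cvg_snd.
  have c1 : fst @ nbhs ((0 : R^o), (z0, v0)) --> (0 : R) by exact: cvg_fst.
  have := cvg_pair (tvs_cvgD c21 (tvs_cvgZ c1 c22)) c22.
  by rewrite scale0r addr0 => H; exact: H.
move=> /(_ _ nN)[[A B]/= [A0 [[B1 B2]/= [B1z B2v] B12]] AB].
have [d /= d0 dA] := A0.
near=> t.
have tt0 : tau t != 0 by near: t.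
have Nt s : 0 <= s <= 1 -> N (zt t + (s * tau t) *: vt t, vt t).
  move=> /andP[s0 s1]; apply: (AB (s * tau t, (zt t, vt t))); split => /=.
    apply: dA => /=; rewrite sub0r normrN normrM ger0_norm//.
    rewrite (@le_lt_trans _ _ `|tau t|)// ?ler_piMl//.
    by near: t; exact: (cvgr0_norm_lt _ ct).
  by apply: B12; split => /=; near: t; [exact: cz|exact: cv].
rewrite distrC scalerBr.
apply: (@mean_value_line _ _ _ (fun y => (tau t)^-1 *: g y)
  (fun s => dg (zt t + (s * tau t) *: vt t) (vt t))) => s s01; rewrite ?scalerA.
  have := cvg_comp _ _ (cvg_dnbhs0_mulr tt0) (gd (v := vt t) (Nt s s01).2).
  apply: cvg_trans; apply: near_eq_cvg; apply: nearW => r.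
  by rewrite /= /dir_quotient -scalerBr !scalerA invfM.
by rewrite distrC; exact: (Nt s s01).1.
Unshelve. all: by end_near. Qed.

End Hadamard.

(** * Multilinearity of higher derivatives *)

Section LinearDerivative.
Context (R : realType) (E : tvsType R) (W : normedModType R) (U : set E).
Context (g : E -> W) (dg : E -> E -> W).
Hypothesis oU : open U.
Hypothesis gd : forall z v, U z -> dir_quotient g z v t @[t --> 0^'] --> dg z v.
Hypothesis gc : forall z v, U z -> dg p.1 p.2 @[p --> (z, v)] --> dg z v.

(** Additivity comes from moving first along [x] and then along [y]: the second quotient starts at
    the moving point [z + t *: x]. Homogeneity substitutes [t * r] for [t] when [r != 0]; at [r = 0]
    additivity alone gives the value [0]. *)
Lemma C1_derive_linear z (r : R) (u v : E) : U z ->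
  dg z (r *: u + v) = r *: dg z u + dg z v.
Proof.
move=> Uz.
have dD (x y : E) : dg z (x + y) = dg z x + dg z y.
  apply: (cvg_unique (@norm_hausdorff _ W) (gd Uz)).
  have cy : y @[t --> (0 : R)^'] --> y by exact: cvg_cst.
  have hq : t^-1 *: (g (z + t *: x + t *: y) - g (z + t *: x)) @[t --> (0 : R)^']
      --> dg z y.
    exact: (C1_difference_quotient oU gd gc Uz (@cvg_line _ _ z x) cy
      (@cvg_id_dnbhs0 R) (nbhs_dnbhs_neq _)).
  apply: cvg_trans (cvgD (gd (v := x) Uz) hq).
  apply: near_eq_cvg; apply: nearW => t.
  rewrite /dir_quotient !fctE -scalerDr; congr (_ *: _).
  by rewrite addrC addrA subrK scalerDr addrA.
rewrite dD; congr (_ + _).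
have [->|r0] := eqVneq r 0.
  rewrite !scale0r; apply: (addrI (dg z 0)).
  by rewrite -dD !addr0.
apply: (cvg_unique (@norm_hausdorff _ W) (gd Uz)).
have hq : (dir_quotient g z u \o (fun t => t * r)) t @[t --> 0^'] --> dg z u.
  exact: (cvg_comp _ _ (cvg_dnbhs0_mulr r0) (gd (v := u) Uz)).
apply: cvg_trans (cvgZr (k := r) hq).
apply: near_eq_cvg; apply: nearW => t.
by rewrite /dir_quotient/= !scalerA invfM mulrCA mulfV// mulr1.
Qed.

End LinearDerivative.

(** [nderive] differentiates along the last entry last, so [snoc a v] is the family of directions
    for the derivative of [nderive f y a] along [v]. *)
Definition snoc (T : Type) k (a : 'I_k -> T) (v : T) (i : 'I_k.+1) : T :=
  if unlift ord_max i is Some j then a j else v.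

Lemma snoc_max (T : Type) k (a : 'I_k -> T) v : snoc a v ord_max = v.
Proof. by rewrite /snoc unlift_none. Qed.

Lemma snoc_widen (T : Type) k (a : 'I_k -> T) v i :
  snoc a v (widen_ord (leqnSn k) i) = a i.
Proof.
rewrite /snoc (_ : widen_ord _ _ = lift ord_max i) ?liftK//.
by apply: val_inj; rewrite /= /bump leqNgt ltn_ord.
Qed.

Lemma snocE (T : Type) k (a : 'I_k.+1 -> T) :
  snoc (fun i => a (widen_ord (leqnSn k) i)) (a ord_max) = a.
Proof.
apply/funext => i; rewrite /snoc; case: unliftP => [j ->|->//]; congr a.
by apply: val_inj; rewrite /= /bump leqNgt ltn_ord.
Qed.

Definition upd (T : Type) k (a : 'I_k -> T) (i : 'I_k) (v : T) (j : 'I_k) : T :=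
  if j == i then v else a j.

Section HigherDerivatives.
Context (R : realType) (E : tvsType R) (W : normedModType R) (U : set E).
Context (f : E -> W).
Hypothesis oU : open U.
Hypothesis smoothf : smooth_on U f.

(** Over the open set [U] continuity within the subspace is ordinary continuity, and the pointwise
    topology lets the directions converge one by one. *)
Lemma nderive_cvg (T : Type) (FF : set_system T) {FFF : Filter FF} k
    (zt : T -> E) (a_ : T -> 'I_k -> E) z (a : 'I_k -> E) :
  U z -> zt @ FF --> z -> (forall i, a_^~ i @ FF --> a i) ->
  nderive f (zt t) (a_ t) @[t --> FF] --> nderive f z a.
Proof.
move=> Uz cz ca.
have [_] := smoothf k.
have oUT : open (U `*` [set: {ptws 'I_k -> E}]).
  rewrite openE => -[x h] [/= Ux _]; exists (U, setT) => //.
  by split => /=; [exact: open_nbhs_nbhs|exact: filterT].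
rewrite continuous_open_subspace// => /(_ (z, a)).
rewrite inE => /(_ (conj Uz I)) H.
have cat : (a_ : T -> {ptws 'I_k -> E}) @ FF --> (a : {ptws 'I_k -> E}).
  apply/cvg_sup => i A [B [[C oC <-] Ca] CA].
  by apply: filterS CA _; apply: (ca i); exact: open_nbhs_nbhs.
exact: (cvg_comp _ _ (cvg_pair cz cat) H).
Qed.

Lemma nderive_dir k z (a : 'I_k -> E) v : U z ->
  dir_quotient (fun y => nderive f y a) z v t @[t --> 0^'] -->
  nderive f z (snoc a v).
Proof.
move=> Uz; have [/(_ z a v Uz) fd _] := smoothf k.
rewrite /= snoc_max.
rewrite (_ : (fun i => snoc a v _) = a); last first.
  by apply/funext => i; rewrite snoc_widen.
by rewrite /dir_derive; case: xgetP => [l _ //|/(_ _)]; case: fd => l + /(_ l).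
Qed.

Lemma nderive_C1 k (a : 'I_k -> E) z v : U z ->
  nderive f p.1 (snoc a p.2) @[p --> (z, v)] --> nderive f z (snoc a v).
Proof.
move=> Uz; apply: nderive_cvg => //; first exact: cvg_fst.
move=> i; rewrite /snoc; case: unlift => [j|]; first exact: cvg_cst.
exact: cvg_snd.
Qed.

(** Induction on [k]. The last slot is the linearity of a directional derivative; for an earlier
    slot, the identity of one order less holds at every point of [U] and is differentiated along the
    common last direction. *)
Lemma nderive_linear k z (i : 'I_k) (r : R) (a b c : 'I_k -> E) : U z ->
  (forall j, j != i -> a j = b j /\ a j = c j) -> a i = r *: b i + c i ->
  nderive f z a = r *: nderive f z b + nderive f z c.
Proof.
elim: k z i a b c => [|k IH] z i a b c Uz abc ai; first by case: i abc ai.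
have [im|im] := eqVneq i ord_max.
  rewrite -(snocE a) -(snocE b) -(snocE c).
  have wi (j : 'I_k) : widen_ord (leqnSn k) j != i.
    by rewrite im -val_eqE/= ltn_eqF.
  have -> : (fun j => b (widen_ord (leqnSn k) j)) =
      (fun j => a (widen_ord (leqnSn k) j)).
    by apply/funext => j; rewrite (abc _ (wi j)).1.
  have -> : (fun j => c (widen_ord (leqnSn k) j)) =
      (fun j => a (widen_ord (leqnSn k) j)).
    by apply/funext => j; rewrite -(abc _ (wi j)).2.
  move: ai; rewrite im => ->.
  set a' := fun j => a _.
  apply: (C1_derive_linear (g := fun y => nderive f y a')
    (dg := fun y v => nderive f y (snoc a' v)) oU) => //.
    by move=> y v; exact: nderive_dir.
  by move=> y v; exact: nderive_C1.
pose w (a : 'I_k.+1 -> E) j := a (widen_ord (leqnSn k) j).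
have [i' ii'] : exists i' : 'I_k, i = widen_ord (leqnSn k) i'.
  have ik : (i < k)%N.
    by have := ltn_ord i; rewrite ltnS leq_eqVlt -val_eqE/= in im *; rewrite (negbTE im).
  by exists (Ordinal ik); apply: val_inj.
have IHy y : U y -> nderive f y (w a) = r *: nderive f y (w b) + nderive f y (w c).
  move=> Uy; apply: (IH _ i') => //; last by rewrite /w -ii'.
  by move=> j ji; apply: abc; rewrite ii' -val_eqE.
have ma : ord_max != i by rewrite eq_sym.
have := nderive_dir (a := w a) (v := a ord_max) Uz; rewrite snocE => la.
apply: (cvg_unique (@norm_hausdorff _ W) la).
have := nderive_dir (a := w b) (v := a ord_max) Uz; rewrite {2}(abc _ ma).1 snocE => lb.
have := nderive_dir (a := w c) (v := a ord_max) Uz; rewrite {2}(abc _ ma).2 snocE => lc.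
apply: cvg_trans (cvgD (cvgZr (k := r) lb) lc); apply: near_eq_cvg.
have : \forall t \near (0 : R)^', U (z + t *: a ord_max).
  by apply: (@cvg_line _ _ z (a ord_max)); exact: open_nbhs_nbhs.
apply: filterS => t Ut; rewrite !fctE /dir_quotient.
rewrite (IHy _ Ut) (IHy _ Uz) /= scalerA mulrC -scalerA -scalerDr; congr (_ *: _).
by rewrite scalerBr opprD addrACA.
Qed.

Lemma nderive_eq0 k z (i : 'I_k) (a : 'I_k -> E) : U z -> a i = 0 ->
  nderive f z a = 0.
Proof.
move=> Uz ai; have := @nderive_linear k z i 1 a a a Uz.
rewrite ai !scale1r addr0 => /(_ (fun _ _ => conj erefl erefl) erefl) aa.
by apply: (addrI (nderive f z a)); rewrite addr0 -aa.
Qed.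

Lemma nderive_scale k z (i : 'I_k) (r : R) (a b : 'I_k -> E) : U z ->
  (forall j, j != i -> a j = b j) -> a i = r *: b i ->
  nderive f z a = r *: nderive f z b.
Proof.
move=> Uz ab ai; rewrite (@nderive_linear k z i r a b (upd a i 0))//.
- by rewrite (@nderive_eq0 _ _ i (upd a i 0)) ?addr0// /upd eqxx.
- by move=> j ji; rewrite /upd (negbTE ji) ab.
- by rewrite ai /upd eqxx addr0.
Qed.

(** The base point is moved first, at fixed directions. Changing one direction afterwards is exact
    by multilinearity, so each such quotient is itself a value of [nderive] and converges by
    continuity. *)
Lemma nderive_chain k (zt : R -> E) (a_ : R -> 'I_k -> E) z dz
    (a da : 'I_k -> E) : U z ->
  t^-1 *: (zt t - z) @[t --> 0^'] --> dz ->
  (forall i, t^-1 *: (a_ t i - a i) @[t --> 0^'] --> da i) ->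
  t^-1 *: (nderive f (zt t) (a_ t) - nderive f z a) @[t --> 0^'] -->
  nderive f z (snoc a dz) + \sum_(i < k) nderive f z (upd a i (da i)).
Proof.
move=> Uz cz ca; have cz0 := cvg_difference_quotient cz.
have ca0 i := cvg_difference_quotient (ca i).
(* The arguments are replaced one at a time. *)
pose mix t (m : nat) (j : 'I_k) := if (j < m)%N then a_ t j else a j.
pose q t i := t^-1 *: (a_ t i - a i).
have c1 : t^-1 *: (nderive f (z + t *: (t^-1 *: (zt t - z))) a - nderive f z a)
    @[t --> 0^'] --> nderive f z (snoc a dz).
  have zz : z @[t --> (0 : R)^'] --> z by exact: cvg_cst.
  apply: (C1_difference_quotient (g := fun y => nderive f y a)
    (dg := fun y v => nderive f y (snoc a v)) oU _ _ Uz zz cz (@cvg_id_dnbhs0 R)).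
  - by move=> y v; exact: nderive_dir.
  - by move=> y v; exact: nderive_C1.
  - exact: nbhs_dnbhs_neq.
have c2 (i : 'I_k) : nderive f (zt t) (upd (mix t i) i (q t i)) @[t --> 0^'] -->
    nderive f z (upd a i (da i)).
  apply: nderive_cvg => // j; rewrite /upd.
  have [_|ji] := eqVneq j i; first exact: ca.
  by rewrite /mix; case: (j < i)%N; [exact: ca0|exact: cvg_cst].
have c3 : \sum_(i < k) nderive f (zt t) (upd (mix t i) i (q t i)) @[t --> 0^'] -->
    \sum_(i < k) nderive f z (upd a i (da i)).
  by apply: cvg_big => [|i _]; [exact: add_continuous|exact: c2].
apply: cvg_trans (cvgD c1 c3); apply: near_eq_cvg.
near=> t.
have t0 : t != 0 by near: t; exact: nbhs_dnbhs_neq.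
have Ut : U (zt t) by near: t; apply: cz0; exact: open_nbhs_nbhs.
rewrite fctE scalerA mulfV// scale1r (addrC z) subrK.
have -> : nderive f (zt t) (a_ t) - nderive f z a =
    (nderive f (zt t) a - nderive f z a) +
    (nderive f (zt t) (mix t k) - nderive f (zt t) (mix t 0)).
  have -> : mix t k = a_ t by apply/funext => j; rewrite /mix ltn_ord.
  have -> : mix t 0 = a by apply/funext => j; rewrite /mix ltn0.
  by rewrite [RHS]addrC addrA subrK.
rewrite [RHS]scalerDr; congr (_ + _).
rewrite -(telescope_sumr (fun m => nderive f (zt t) (mix t m)))// big_mkord.
rewrite [RHS]scaler_sumr; apply: eq_bigr => i _.
(* [mix t i.+1] and [mix t i] differ only at [i], by [t *: q t i]. *)
have := @nderive_linear k (zt t) i t (mix t i.+1) (upd (mix t i) i (q t i))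
  (mix t i) Ut.
move=> ->; first by rewrite addrK scalerA mulVf// scale1r.
  move=> j ji; rewrite /upd (negbTE ji) /mix ltnS leq_eqVlt.
  by rewrite (negbTE (_ : (j : nat) != i)).
rewrite /upd eqxx /mix ltnSn ltnn /q scalerA mulfV// scale1r subrK.
by [].
Unshelve. all: by end_near. Qed.

End HigherDerivatives.

(** * Bounded inverses and perturbed equations *)

Section BoundedInverse.
Context (R : realType) (V W : completeNormedModType R).
Context (A : {linear V -> W}) (B : W -> V) (M : R).
Hypothesis AM : forall v, `|A v| <= M * `|v|.
Hypothesis BK : cancel B A.

(* Baire's theorem puts a ball inside the closure of the image of a ball. *)
Lemma approximate_preimage : exists2 K : R, 0 < K &
  forall w, exists v, `|v| <= K * `|w| /\ `|w - A v| <= 2^-1 * `|w|.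
Proof.
pose C n := closure [set A v | v in [set v : V | `|v| <= n%:R]].
have [n nd] : exists n, ~ dense (~` C n).
  (* Otherwise Baire's theorem yields a [w] outside every [C n], although [w = A (B w)] lies in
     [C n] as soon as [n] exceeds the norm of [B w]. *)
  apply: contrapT => /forallNP nC.
  have : dense (\bigcap_n ~` C n).
    apply: Baire => n; split; last exact: contrapT (nC n).
    by apply: closed_openC; exact: closed_closure.
  move=> /(_ setT) []; [by exists 0|exact: openT|].
  move=> w [_ /(_ (Num.truncn `|B w|).+1 I)]; apply.
  apply: subset_closure; exists (B w) => //=.
  by rewrite ltW// Num.Theory.truncnS_gt.
have [x0 [r r0 x0r]] : exists x0, exists2 r : R, 0 < r & ball x0 r `<=` C n.
  have [D [[x0 oD] /disjoints_subset DC]] := denseNE nd.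
  have /nbhs_ballP[r r0 rD] := open_nbhs_nbhs oD.
  by exists x0, r => //; apply: subset_trans rD _; rewrite -[C n]setCK.
(* Both [x0] and [x0 + s *: w] are approximated within [r / 8] by images of vectors of norm at most
   [n]; the difference over [s = r / (2 * |w|)] has norm at most [4 * n / r * |w|] and error at most
   [|w| / 2]. The successor keeps [K] positive. *)
pose K := 4 * n.+1%:R / r; exists K; first by rewrite !mulr_gt0// invr_gt0.
move=> w; have [->|wn0] := eqVneq w 0.
  by exists 0; rewrite linear0 subrr !normr0 !mulr0.
have w_gt0 : 0 < `|w| by rewrite normr_gt0.
pose s := r / (2 * `|w|).
have s0 : 0 < s by rewrite divr_gt0// mulr_gt0.
have approx x : ball x0 r x -> exists2 v, `|v| <= n%:R & `|x - A v| < r / 8.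
  move=> /x0r /(_ (ball x (r / 8))) [|_ [[v vn <-]]].
    by apply: nbhsx_ballx; rewrite divr_gt0.
  by rewrite -ball_normE /=; exists v.
have [v1 v1n v1d] : exists2 v, `|v| <= n%:R & `|(x0 + s *: w) - A v| < r / 8.
  apply: approx; rewrite -ball_normE /= opprD addrA subrr sub0r normrN normrZ.
  rewrite gtr0_norm// /s invfM -mulrA mulfVK ?gt_eqF//.
  by rewrite ltr_pdivrMr// ltr_pMr// ltr1n.
have [v2 v2n v2d] := approx x0 (ballxx _ r0).
exists (s^-1 *: (v1 - v2)); split.
  rewrite normrZ gtr0_norm ?invr_gt0//.
  rewrite (_ : K * `|w| = s^-1 * (n.+1%:R + n.+1%:R)); last first.
    by rewrite /K /s; field; rewrite !gt_eqF.
  rewrite ler_pM2l ?invr_gt0// (le_trans (ler_normB _ _))//.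
  by rewrite lerD// (le_trans v1n, le_trans v2n)// ler_nat.
rewrite linearZ linearB/= -(ler_pM2l s0) -{1}(gtr0_norm s0) -normrZ.
rewrite [_ *: (w - _)]scalerBr scalerA mulfV ?gt_eqF// scale1r.
rewrite (_ : s * _ = r / 8 + r / 8); last by rewrite /s; field; rewrite gt_eqF.
rewrite (_ : _ - _ = (x0 + s *: w - A v1) - (x0 - A v2)); last first.
  rewrite !opprB [x0 + _]addrC [_ + x0 - _]addrAC [A v2 - x0]addrC [RHS]addrA addrK.
  by rewrite addrA addrAC.
by rewrite (le_trans (ler_normB _ _))// lerD// ltW.
Qed.

(** Successive approximation: each correction halves the remaining error, so the corrections sum to
    an exact preimage of norm at most [K * (1 + 1/2 + ...) * |w|]. Injectivity identifies it with
    the given vector. *)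
Lemma bounded_inverse : injective A -> exists2 K : R, 0 < K &
  forall v, `|v| <= K * `|A v|.
Proof.
move=> Ainj; have [K K0 /choice[g gP]] := approximate_preimage.
exists (2 * K); first by rewrite mulr_gt0.
move=> v0; set w := A v0.
pose w_ n := iter n (fun x => x - A (g x)) w.
have wn n : `|w_ n| <= 2^-1 ^+ n * `|w|.
  elim: n => [|n IH]; first by rewrite expr0 mul1r.
  by rewrite /= (le_trans (gP _).2)// exprS -mulrA ler_pM2l.
pose v_ n := g (w_ n).
have vn n : `|v_ n| <= 2^-1 ^+ n * (K * `|w|).
  by rewrite (le_trans (gP _).1)// mulrCA ler_pM2l.
have sv n : A (series v_ n) = w - w_ n.
  elim: n => [|n IH]; first by rewrite /series/= big_geq// linear0 subrr.
  by rewrite seriesSr linearD IH /= /v_ opprD opprK addrA.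
have sn n : `|series v_ n| <= 2 * K * `|w|.
  rewrite /series /= (le_trans (ler_norm_sum _ _ _))//.
  rewrite (@le_trans _ _ (series (geometric (K * `|w|) 2^-1) n))//.
    by rewrite ler_sum// => i _; rewrite /= mulrC vn.
  rewrite -[leRHS]mulrA geometric_seriesE/=; last by rewrite lt_eqF// invf_lt1// ltr1n.
  have : 0 <= (2^-1 : R) ^+ n by rewrite exprn_ge0.
  have : 0 <= K * `|w| by rewrite mulr_ge0// ltW.
  move: (K * `|w|) (2^-1 ^+ n) => a b a0 b0.
  have half : 1 - 2^-1 = 2^-1 :> R by field.
  rewrite half invrK; have := mulr_ge0 a0 b0; lra.
have cv : cvgn (series v_).
  apply: normed_cvg; apply: (@series_le_cvg _ _ (geometric (K * `|w|) 2^-1)) => //.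
  - by move=> n; rewrite /= normr_ge0.
  - by move=> n /=; rewrite mulr_ge0 ?exprn_ge0// mulr_ge0// ltW.
  - by move=> n; rewrite /= mulrC vn.
  - by apply: is_cvg_geometric_series; rewrite gtr0_norm ?invr_gt0// invf_lt1// ltr1n.
have -> : v0 = limn (series v_).
  apply: Ainj; apply/eqP; rewrite -subr_eq0 -normr_le0; apply/ler_addgt0Pr => e e0.
  (* The residual splits into [w_ n], at most [e / 2], and the image of the tail, at most
     [|M| * e' <= e / 2]; the added [1] avoids a division by [0]. *)
  rewrite add0r; pose e' := e / 2 / (`|M| + 1).
  have M1 : 0 < `|M| + 1 by rewrite ltr_wpDl.
  have e'0 : 0 < e' by rewrite !divr_gt0.
  have cg : geometric `|w| 2^-1 n @[n --> \oo] --> (0 : R).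
    by apply: cvg_geometric; rewrite gtr0_norm ?invr_gt0// invf_lt1// ltr1n.
  near \oo => n.
  have wne : `|w_ n| <= e / 2.
    rewrite (le_trans (wn n))// mulrC (le_trans (ler_norm _))//.
    by near: n; apply: (cvgr0_norm_le _ cg); rewrite divr_gt0.
  have sne : `|limn (series v_) - series v_ n| <= e'.
    by near: n; move/cvgrPdist_le: cv; exact.
  rewrite -/w -[limn _](subrK (series v_ n)) linearD sv /=.
  rewrite opprD opprB addrCA subrKC addrC.
  rewrite (le_trans (ler_normB _ _))//.
  have := AM (limn (series v_) - series v_ n).
  have := ler_wpM2l (normr_ge0 M) sne.
  have : M * `|limn (series v_) - series v_ n| <=
     `|M| * `|limn (series v_) - series v_ n| by rewrite ler_wpM2r// ler_norm.
  have : `|M| * e' <= e / 2.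
    by rewrite /e' mulrCA ger_pMr ?divr_gt0// ler_pdivrMr// mul1r lerDl.
  lra.
apply/ler_addgt0Pr => e e0; have /cvgrPdist_le/(_ _ e0)[n _ /(_ n (leqnn n)) cn] := cv.
rewrite -[limn _](subrK (series v_ n)) addrC (le_trans (ler_normD _ _))// lerD//.
Unshelve. all: by end_near. Qed.

End BoundedInverse.

(** * The contraction principle near an invertible linear map *)

Section PerturbedRoot.
Context (R : realType) (V : completeNormedModType R) (W : normedModType R).
Context (A : {linear V -> W}) (B : W -> V) (K : R).
Hypothesis K0 : 0 < K.
Hypothesis AK : forall v, `|v| <= K * `|A v|.
Hypothesis BK : cancel B A.

(* By contraction: roots of [f] are the fixed points of [y - A^-1 (f y)]. *)
Lemma perturbed_root (f : V -> W) (y0 : V) (rho : R) : 0 <= rho ->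
  (forall y y', `|y - y0| <= rho -> `|y' - y0| <= rho ->
     `|f y - f y' - A (y - y')| <= (2 * K)^-1 * `|y - y'|) ->
  `|f y0| <= rho / (2 * K) ->
  exists2 y, `|y - y0| <= rho & f y = 0.
Proof.
move=> rho0 fA fy0; pose D := [set y : V | `|y - y0| <= rho].
pose T y := y - B (f y).
(* [A] sends [T y - T y'] to [A (y - y') - (f y - f y')], so the contraction factor is
   [K * (2 * K)^-1 = 1/2]. *)
have TT y y' : D y -> D y' -> `|T y - T y'| <= 2^-1 * `|y - y'|.
  move=> Dy Dy'; rewrite (le_trans (AK _))//.
  rewrite -ler_pdivlMl// mulrA -invfM [K * 2]mulrC.
  rewrite (le_trans _ (fA _ _ Dy Dy'))// distrC.
  rewrite /T !linearB !BK /=.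
  by rewrite addrACA.
have DT : {homo T : y / D y >-> D y}.
  move=> y Dy; have Dy0 : D y0 by rewrite /D /= subrr normr0.
  rewrite /D/= -[T y](subrK (T y0)) -addrA (le_trans (ler_normD _ _))//.
  (* The centre moves by at most [K * (rho / (2 * K)) = rho / 2], and the contraction adds at most
     another [rho / 2]. *)
  have := TT _ _ Dy Dy0; have : `|T y0 - y0| <= rho / 2.
    rewrite /T addrAC subrr sub0r normrN (le_trans (AK _))// BK.
    by rewrite -ler_pdivlMl// mulrC -mulrA -invfM.
  by move: Dy; rewrite /D/=; lra.
have cD : closed D.
  apply: (@closed_comp _ _ (fun y => `|y - y0|) [set x | x <= rho]) => [y _|].
    by apply: cvg_norm; apply: cvgB; [exact: cvg_id|exact: cvg_cst].
  exact: closed_le.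
have cT : is_contraction (mkfun DT).
  exists 2^-1%:nng; split; first by rewrite /= invf_lt1// ltr1n.
  by move=> [y y'] [/= Dy Dy']; exact: TT.
have [|y Dy yT] := banach_fixed_point cT cD.
  by exists y0; rewrite /D /= subrr normr0.
exists y => //; rewrite -[f y]BK.
suff -> : B (f y) = 0 by exact: linear0.
by move/eqP: yT; rewrite -subr_eq0 /= /T opprB addrCA subrr addr0 => /eqP.
Qed.

(** [AK] gives [|y - y'| <= |y - y'| / 2 + K * |f y - f y'|]; absorbing the first term on the left
    doubles the constant. *)
Lemma perturbed_injective (f : V -> W) (y y' : V) :
  `|f y - f y' - A (y - y')| <= (2 * K)^-1 * `|y - y'| ->
  `|y - y'| <= 2 * K * `|f y - f y'|.
Proof.
move=> H; have := AK (y - y').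
have : `|A (y - y')| <= (2 * K)^-1 * `|y - y'| + `|f y - f y'|.
  rewrite -[A _](subrK (f y - f y')) (le_trans (ler_normD _ _))// lerD//.
  by rewrite distrC.
move: `|A _| => a ha /le_trans; move=> /(_ (K * ((2 * K)^-1 * `|y - y'| + `|f y - f y'|))).
rewrite ler_pM2l// => /(_ ha); rewrite mulrDr mulrA invfM mulrCA mulfV ?gt_eqF//.
by lra.
Qed.

End PerturbedRoot.

(** * Smoothness of the implicit function *)

Lemma snoc_map (S T : Type) (g : S -> T) k (a : 'I_k -> S) v :
  (fun i => g (snoc a v i)) = snoc (fun i => g (a i)) (g v).
Proof. by apply/funext => i; rewrite /snoc; case: unlift. Qed.

Lemma upd_map (S T : Type) (g : S -> T) k (a : 'I_k -> S) i v :
  (fun j => g (upd a i v j)) = upd (fun j => g (a j)) i (g v).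
Proof. by apply/funext => j; rewrite /upd; case: ifP. Qed.

Section ImplicitSmooth.
Context (R : realType) (F : tvsType R) (V W : normedModType R).
Context (U : set (F * V)) (phi : F * V -> W) (U' : set F) (U'' : set V).
Context (psi : F -> V) (K : R).
Hypothesis oU : open U.
Hypothesis smoothphi : smooth_on U phi.
Hypothesis oU' : open U'.
Hypothesis oU'' : open U''.
Hypothesis U'U : U' `*` U'' `<=` U.
Hypothesis psiU'' : forall x, U' x -> U'' (psi x).
Hypothesis phi0 : forall x, U' x -> phi (x, psi x) = 0.
Hypothesis K0 : 0 < K.
Hypothesis psi_lip : forall x y, U' x -> U'' y -> `|y - psi x| <= K * `|phi (x, y)|.

Let B x v := nderive phi (x, psi x) (fun _ : 'I_1 => (0 : F, v)).

Hypothesis B_lip : forall x v, U' x -> `|v| <= K * `|B x v|.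

Context (L : F -> W -> V).
Hypothesis BL : forall x w, U' x -> B x (L x w) = w.

Let psiU x : U' x -> U (x, psi x).
Proof. by move=> Ux; apply: U'U; split => //=; exact: psiU''. Qed.

Let B_linear x r u v : U' x -> B x (r *: u + v) = r *: B x u + B x v.
Proof.
move=> Ux; rewrite /B.
apply: (nderive_linear (U := U) oU smoothphi (i := ord0)) => //; first exact: psiU.
  by move=> j; rewrite ord1 eqxx.
by congr (_, _); rewrite /= scaler0 addr0.
Qed.

Let B_scale x r u : U' x -> B x (r *: u) = r *: B x u.
Proof.
move=> Ux; have B0 : B x 0 = 0.
  by have := B_linear (-1) 0 0 Ux; rewrite !scaleN1r !addNr.
by rewrite -[r *: u]addr0 B_linear// B0 addr0.
Qed.

Let B_inj x u v : U' x -> B x u = B x v -> u = v.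
Proof.
move=> Ux Buv; apply/eqP; rewrite -subr_eq0 -normr_le0 (le_trans (B_lip _ Ux))//.
by rewrite -scaleN1r addrC B_linear// Buv scaleN1r addNr normr0 mulr0.
Qed.

(** [L x] is given as a right inverse of [B x]; the lower bound [B_lip] makes [B x] injective, so
    identities for [L x] can be checked after applying [B x]. *)
Let L_linear x r u v : U' x -> L x (r *: u + v) = r *: L x u + L x v.
Proof. by move=> Ux; apply: (B_inj Ux); rewrite B_linear// !BL. Qed.

Let L_scale x r u : U' x -> L x (r *: u) = r *: L x u.
Proof. by move=> Ux; apply: (B_inj Ux); rewrite B_scale// !BL. Qed.

Let L_sub x u v : U' x -> L x (u - v) = L x u - L x v.
Proof. by move=> Ux; rewrite -scaleN1r addrC L_linear// scaleN1r addrC. Qed.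

(** [psi_lip] bounds the distance from [psi (xt t)] to the fixed point [psi x] by [K] times the norm
    of [phi (xt t, psi x)], which tends to [0] because [phi (x, psi x) = 0]. *)
Lemma implicit_cvg (T : Type) (FF : set_system T) {FFF : Filter FF}
    (xt : T -> F) x : U' x -> xt @ FF --> x -> psi (xt t) @[t --> FF] --> psi x.
Proof.
move=> Ux cx; apply/cvgrPdist_le => e e0.
have cphi : phi (xt t, psi x) @[t --> FF] --> 0.
  rewrite -(phi0 Ux); pose a (i : 'I_0) : F * V := 0.
  have := @nderive_cvg _ _ _ U phi oU smoothphi _ FF _ 0%N (fun t => (xt t, psi x))
    (fun _ => a) (x, psi x) a (psiU Ux).
  by apply => //; [apply: cvg_pair => //; exact: cvg_cst|case].
have eK : 0 < e / K by rewrite divr_gt0.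
near=> t.
have Ut : U' (xt t) by near: t; apply: cx; exact: open_nbhs_nbhs.
rewrite (le_trans (psi_lip Ut (psiU'' Ux)))// -ler_pdivlMl// mulrC.
by near: t; exact: (cvgr0_norm_le _ cphi).
Unshelve. all: by end_near. Qed.

(** [B (xt t)] sends the difference of [L x w] and [L (xt t) (wt t)] to [B (xt t) (L x w) - wt t],
    which tends to [0]; the uniform constant in [B_lip] carries this back. *)
Lemma implicit_inverse_cvg (T : Type) (FF : set_system T) {FFF : Filter FF}
    (xt : T -> F) (wt : T -> W) x w : U' x -> xt @ FF --> x -> wt @ FF --> w ->
  L (xt t) (wt t) @[t --> FF] --> L x w.
Proof.
move=> Ux cx cw; apply/cvgrPdist_le => e e0.
have cB : B (xt t) (L x w) @[t --> FF] --> w.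
  rewrite -[X in _ --> nbhs X](BL w Ux); apply: (nderive_cvg oU smoothphi) => //.
  - exact: psiU.
  - by apply: cvg_pair => //; exact: implicit_cvg.
  - by move=> i; exact: cvg_cst.
have eK : 0 < e / K by rewrite divr_gt0.
near=> t.
have Ut : U' (xt t) by near: t; apply: cx; exact: open_nbhs_nbhs.
rewrite (le_trans (B_lip _ Ut))// -ler_pdivlMl// mulrC.
rewrite -scaleN1r addrC B_linear// scaleN1r addrC BL//.
near: t; apply: (cvgr0_norm_le (fun t => B (xt t) (L x w) - wt t)) eK.
by rewrite -(subrr w); exact: cvgB cB cw.
Unshelve. all: by end_near. Qed.

(* The maps obtained from [psi] by repeated differentiation, the directions
   being the values of [h]; [V] is embedded into [F * V] so that they can serve
   as arguments of the derivatives of [phi]. *)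
Inductive implicit_term : (F -> (nat -> F) -> F * V) -> Prop :=
| term_dir m : implicit_term (fun _ h => (h m, 0))
| term_psi : implicit_term (fun x _ => (0, psi x))
| term_inv k (a : 'I_k -> F -> (nat -> F) -> F * V) :
    (forall i, implicit_term (a i)) ->
    implicit_term (fun x h =>
      (0, L x (nderive phi (x, psi x) (fun i => a i x h))))
| term_opp a : implicit_term a -> implicit_term (fun x h => - a x h)
| term_add a b : implicit_term a -> implicit_term b ->
    implicit_term (fun x h => a x h + b x h).

Lemma term_sum (I : Type) (r : seq I) (b : I -> F -> (nat -> F) -> F * V) :
  (forall i, implicit_term (b i)) ->
  implicit_term (fun x h => \sum_(i <- r) b i x h).
Proof.
move=> gb; elim: r => [|i r IH].
  (* The class has no constructor for [0], so the empty sum is written as [psi] minus itself. *)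
  rewrite (_ : (fun _ _ => _) = fun x h => (0, psi x) + - (0, psi x)).
    by apply: term_add; [|apply: term_opp]; exact: term_psi.
  by apply/funext => x; apply/funext => h; rewrite big_nil subrr.
rewrite (_ : (fun _ _ => _) = fun x h => b i x h + \sum_(j <- r) b j x h).
  exact: term_add.
by apply/funext => x; apply/funext => h; rewrite big_cons.
Qed.

Lemma implicit_term_cvg a : implicit_term a ->
  forall (T : Type) (FF : set_system T) (xt : T -> F) (ht : T -> nat -> F) x h,
  Filter FF -> U' x -> xt @ FF --> x -> (forall m, ht^~ m @ FF --> h m) ->
  a (xt t) (ht t) @[t --> FF] --> a x h.
Proof.
elim=> {a} [m||k a ga IH|a ga IH|a b ga IHa gb IHb]
  T FF xt ht x h FFF Ux cx ch.
- by apply: cvg_pair => //; exact: cvg_cst.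
- by apply: cvg_pair; [exact: cvg_cst|exact: implicit_cvg].
- apply: cvg_pair; first exact: cvg_cst.
  apply: implicit_inverse_cvg => //; apply: (nderive_cvg oU smoothphi) => //; first exact: psiU.
    by apply: cvg_pair => //; exact: implicit_cvg.
  by move=> i; exact: IH.
- by apply: tvs_cvgN; exact: IH.
- by apply: tvs_cvgD; [exact: IHa|exact: IHb].
Qed.

(** [d] solves the linearised equation: the derivative of [phi] along [(v, d)] vanishes. Hence
    [phi (x + t *: v, psi x + t *: d)] is [o(t)], and [psi_lip] turns this into the same estimate
    for [psi x + t *: d - psi (x + t *: v)]. *)
Lemma implicit_derive x v : U' x ->
  t^-1 *: (psi (x + t *: v) - psi x) @[t --> 0^'] -->
  - L x (nderive phi (x, psi x) (fun _ : 'I_1 => (v, 0))).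
Proof.
move=> Ux; set d := - L _ _; set z := (x, psi x).
have D0 : nderive phi z (fun _ : 'I_1 => (v, d)) = 0.
  rewrite (@nderive_linear _ _ _ _ _ oU smoothphi 1 z ord0 1 _
    (fun=> (v, 0)) (fun=> (0, d)) (psiU Ux)).
  - by rewrite scale1r -/(B x d) /d -scaleN1r B_scale// BL// scaleN1r subrr.
  - by move=> j; rewrite ord1 eqxx.
  - by rewrite scale1r; congr (_, _); rewrite /= ?addr0 ?add0r.
have cq : t^-1 *: phi (x + t *: v, psi x + t *: d) @[t --> 0^'] --> 0.
  have := nderive_dir smoothphi (k := 0) (a := fun _ => 0) (v := (v, d)) (psiU Ux).
  rewrite (_ : snoc _ _ = fun=> (v, d)); last first.
    apply/funext => i; rewrite (_ : i = ord_max) ?snoc_max//.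
    by rewrite ord1; exact: val_inj.
  rewrite D0; apply: cvg_trans; apply: near_eq_cvg; apply: nearW => t.
  by rewrite /dir_quotient /= phi0// subr0.
apply/cvgrPdist_le => e e0; have eK : 0 < e / K by rewrite divr_gt0.
near=> t.
have t0 : t != 0 by near: t; exact: nbhs_dnbhs_neq.
have Ut : U' (x + t *: v).
  by near: t; apply: (@cvg_line _ _ x v); exact: open_nbhs_nbhs.
have Ut' : U'' (psi x + t *: d).
  near: t; apply: (@cvg_line _ _ (psi x) d); apply: open_nbhs_nbhs.
  by split => //; exact: psiU''.
have -> : d - t^-1 *: (psi (x + t *: v) - psi x) =
    t^-1 *: (psi x + t *: d - psi (x + t *: v)).
  rewrite [psi x + _]addrC -[in RHS]addrA [RHS]scalerDr scalerA mulVf// scale1r; congr (_ + _).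
  by rewrite -scalerN opprB.
rewrite normrZ -ler_pdivlMl ?normr_gt0 ?invr_eq0// (le_trans (psi_lip Ut Ut'))//.
rewrite mulrC -ler_pdivlMr// -mulrA -ler_pdivrMl ?invr_gt0 ?normr_gt0 ?invr_eq0//.
rewrite invrK -normrZ.
by near: t; exact: (cvgr0_norm_le _ cq).
Unshelve. all: by end_near. Qed.

Let inr_derive (c : R -> V) (c0 l : V) :
  t^-1 *: (c t - c0) @[t --> 0^'] --> l ->
  t^-1 *: ((0 : F, c t) - (0, c0)) @[t --> 0^'] --> (0 : F, l).
Proof.
move=> cl; have c0F : (0 : F) @[_ --> (0 : R)^'] --> (0 : F) by exact: cvg_cst.
apply: cvg_trans (cvg_pair c0F cl); apply: near_eq_cvg; apply: nearW => t.
by congr (_, _); rewrite /= subrr scaler0.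
Qed.

(** With [u = L x (w x)] fixed, the quotient equals [L (x + t *: v)] applied to the quotient of [w]
    minus that of [B] at [u], so joint continuity of [L] suffices. *)
Lemma implicit_inverse_derive (w : F -> W) (dw : W) x v dz : U' x ->
  t^-1 *: (w (x + t *: v) - w x) @[t --> 0^'] --> dw ->
  t^-1 *: ((x + t *: v, psi (x + t *: v)) - (x, psi x)) @[t --> 0^'] --> dz ->
  t^-1 *: (L (x + t *: v) (w (x + t *: v)) - L x (w x)) @[t --> 0^'] -->
  L x (dw - nderive phi (x, psi x)
    (snoc (fun _ : 'I_1 => (0, L x (w x))) dz)).
Proof.
move=> Ux cw cz; set u := L x (w x); set D2 := nderive _ _ _.
have cB : t^-1 *: (B (x + t *: v) u - B x u) @[t --> 0^'] --> D2.
  have := @nderive_chain _ _ _ _ _ oU smoothphi 1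
    (fun t => (x + t *: v, psi (x + t *: v))) (fun _ _ => (0, u))
    (x, psi x) dz (fun=> (0, u)) (fun=> 0) (psiU Ux) cz.
  rewrite big1 ?addr0; last first.
    move=> i _; apply: (nderive_eq0 oU smoothphi (i := i) (psiU Ux)).
    by rewrite /upd eqxx.
  apply=> i; under eq_fun do rewrite subrr scaler0; exact: cvg_cst.
have cp : t^-1 *: (w (x + t *: v) - w x) - t^-1 *: (B (x + t *: v) u - B x u)
    @[t --> 0^'] --> dw - D2 by exact: cvgB.
have cL : L (x + t *: v) (t^-1 *: (w (x + t *: v) - w x) -
    t^-1 *: (B (x + t *: v) u - B x u)) @[t --> 0^'] --> L x (dw - D2).
  exact: (implicit_inverse_cvg Ux (@cvg_line _ _ x v) cp).
apply: cvg_trans cL; apply: near_eq_cvg; near=> t.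
have Ut : U' (x + t *: v).
  by near: t; apply: (@cvg_line _ _ x v); exact: open_nbhs_nbhs.
rewrite -scalerBr L_scale//; congr (_ *: _); apply: (B_inj Ut).
rewrite BL//.
have Bsub a b : B (x + t *: v) (a - b) = B (x + t *: v) a - B (x + t *: v) b.
  by rewrite -scaleN1r [a + _]addrC B_linear// scaleN1r addrC.
by rewrite Bsub BL// /u BL// opprB addrA subrK.
Unshelve. all: by end_near. Qed.

(** Structural induction; the directions [h] stay fixed while [x] moves along [h m]. The case of
    [term_inv] combines the chain rule for [nderive] with the derivative of the inverse. *)
Lemma implicit_term_derive a : implicit_term a ->
  forall m, exists2 a', implicit_term a' & forall x h, U' x ->
  t^-1 *: (a (x + t *: h m) h - a x h) @[t --> 0^'] --> a' x h.
Proof.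
pose dpsi m (x : F) (h : nat -> F) : F * V :=
  - (0, L x (nderive phi (x, psi x) (fun _ : 'I_1 => (h m, 0)))).
have tdpsi m : implicit_term (dpsi m).
  apply: term_opp; apply: (@term_inv 1 (fun _ _ h => (h m, 0))) => _.
  exact: term_dir.
have cdpsi m x h : U' x ->
    t^-1 *: ((0 : F, psi (x + t *: h m)) - (0, psi x)) @[t --> 0^'] --> dpsi m x h.
  move=> Ux; rewrite (_ : dpsi m x h =
    (0, - L x (nderive phi (x, psi x) (fun _ : 'I_1 => (h m, 0))))).
    by apply: inr_derive; exact: implicit_derive.
  by congr (_, _); rewrite /= oppr0.
elim=> {a} [n||k a ta IH|a ta IH|a b ta IHa tb IHb] m.
- exists (fun _ _ => 0) => [|x h Ux].
    rewrite (_ : (fun _ _ => _) = fun x h => (0, psi x) + - (0, psi x)).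
      by apply: term_add; [|apply: term_opp]; exact: term_psi.
    by apply/funext => x; apply/funext => h; rewrite subrr.
  by under eq_fun do rewrite subrr scaler0; exact: cvg_cst.
- by exists (dpsi m) => // x h; exact: cdpsi.
- have /choice[a' a'P] : forall i, exists a', implicit_term a' /\
      forall x h, U' x ->
      t^-1 *: (a i (x + t *: h m) h - a i x h) @[t --> 0^'] --> a' x h.
    by move=> i; have [a' ? ?] := IH i m; exists a'.
  (* The velocity of the point [(x, psi x)] along [h m]. *)
  pose dz x h : F * V := (h m, 0) + dpsi m x h.
  have tdz : implicit_term dz by apply: term_add => //; exact: term_dir.
  pose Lk j (b : 'I_j -> F -> (nat -> F) -> F * V) x h : F * V :=
    (0, L x (nderive phi (x, psi x) (fun i => b i x h))).
  pose u x h := L x (nderive phi (x, psi x) (fun i => a i x h)).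
  have tsnoc j (b : 'I_j -> F -> (nat -> F) -> F * V) c :
      (forall i, implicit_term (b i)) -> implicit_term c ->
      implicit_term (Lk j.+1 (snoc b c)).
    by move=> tb tc; apply: term_inv => i; rewrite /snoc; case: unlift.
  (* The summands come from moving the base point, from moving one direction [a i], and from the
     dependence of [L] on the base point; the last one pairs the current value of the term with [dz]
     in the second derivative of [phi]. *)
  exists (fun x h => Lk k.+1 (snoc a dz) x h +
      \sum_(i < k) Lk k (upd a i (a' i)) x h +
      - Lk 2 (snoc (fun _ => Lk k a) dz) x h) => [|x h Ux].
    apply: term_add; last first.
      by apply: term_opp; apply: tsnoc => // _; exact: term_inv.
    apply: term_add; first exact: tsnoc.
    apply: term_sum => i; apply: term_inv => j; rewrite /upd.
    by case: ifP => // _; exact: (a'P i).1.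
  set lim := (X in _ --> X).
  pose z := (x, psi x).
  have cz : t^-1 *: ((x + t *: h m, psi (x + t *: h m)) - z) @[t --> 0^']
      --> dz x h.
    have c1 : (h m, 0) @[t --> (0 : R)^'] --> (h m, 0 : V) by exact: cvg_cst.
    apply: cvg_trans (tvs_cvgD c1 (cdpsi m x h Ux)).
    apply: near_eq_cvg; near=> t.
    have t0 : t != 0 by near: t; exact: nbhs_dnbhs_neq.
    congr (_, _) => /=; last by rewrite add0r.
    by rewrite subrr scaler0 addr0 [x + _]addrC addrK scalerA mulVf// scale1r.
  have ca i := (a'P i).2 x h Ux.
  have cw := nderive_chain oU smoothphi (psiU Ux) cz ca.
  have cI := inr_derive (implicit_inverse_derive
    (w := fun y => nderive phi (y, psi y) (fun i => a i y h)) Ux cw cz).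
  suff -> : lim = (0, L x
      (nderive phi z (snoc (fun i => a i x h) (dz x h)) +
       \sum_(i < k) nderive phi z (upd (fun j => a j x h) i (a' i x h)) -
       nderive phi z (snoc (fun _ : 'I_1 => (0, u x h)) (dz x h)))).
    exact: cI.
  rewrite /lim /Lk.
  have sumE (r : seq 'I_k) (f : 'I_k -> W) :
      \sum_(i <- r) (0 : F, L x (f i)) = (0, L x (\sum_(i <- r) f i)).
    elim: r => [|i r IHr]; rewrite ?big_nil ?big_cons.
      by have := L_scale 0 0 Ux; rewrite !scale0r => ->.
    rewrite IHr; congr (_, _); rewrite /= ?addr0//.
    by have := L_linear 1 (f i) (\sum_(j <- r) f j) Ux; rewrite !scale1r.
  rewrite -!/z.
  have -> : (fun i => snoc a dz i x h) = snoc (fun i => a i x h) (dz x h).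
    exact: (snoc_map (fun b => b x h)).
  have -> : (fun i => snoc (fun=> Lk k a) dz i x h) =
      snoc (fun _ : 'I_1 => (0, u x h)) (dz x h).
    exact: (snoc_map (fun b => b x h)).
  have -> : \sum_(i < k) (0 : F, L x (nderive phi z (fun j => upd a i (a' i) j x h)))
      = \sum_(i < k) (0, L x (nderive phi z (upd (fun j => a j x h) i (a' i x h)))).
    apply: eq_bigr => i _; congr (_, L x (nderive _ _ _)).
    exact: (upd_map (fun b => b x h)).
  rewrite sumE; apply: injective_projections; first by rewrite /= !add0r oppr0.
  rewrite /= L_sub//; congr (_ - _).
  by rewrite -[X in _ = L x (X + _)]scale1r L_linear// scale1r.
- have [a' ta' ca'] := IH m; exists (fun x h => - a' x h); first exact: term_opp.
  move=> x h Ux; apply: cvg_trans (tvs_cvgN (ca' x h Ux)).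
  apply: near_eq_cvg; apply: nearW => t.
  by rewrite -scalerN opprD.
- have [a' ta' ca'] := IHa m; have [b' tb' cb'] := IHb m.
  exists (fun x h => a' x h + b' x h); first exact: term_add.
  move=> x h Ux; apply: cvg_trans (tvs_cvgD (ca' x h Ux) (cb' x h Ux)).
  apply: near_eq_cvg; apply: nearW => t.
  by rewrite -scalerDr opprD addrACA.
Unshelve. all: by end_near. Qed.

(** All orders read their directions from one sequence [h]: passing from [k] to [k.+1]
    differentiates along the entry [h k] and leaves the previous ones in place. *)
Lemma nderive_implicit k : exists2 a, implicit_term a &
  forall x (h : nat -> F), U' x -> nderive psi x (fun i : 'I_k => h i) = (a x h).2.
Proof.
elim: k => [|k [a ta aE]]; first by exists (fun x _ => (0, psi x)); [exact: term_psi|].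
have [a' ta' a'E] := implicit_term_derive ta k.
exists a' => // x h Ux /=.
have ca' : (fun z : F * V => z.2) (t^-1 *: (a (x + t *: h k) h - a x h)) @[t --> 0^']
    --> (a' x h).2.
  by apply: (cvg_comp _ _ (a'E x h Ux)); exact: cvg_snd.
have cd : dir_quotient (fun y => nderive psi y (fun i : 'I_k => h i)) x (h k) t
    @[t --> 0^'] --> (a' x h).2.
  apply: cvg_trans ca'; apply: near_eq_cvg; near=> t.
  have Ut : U' (x + t *: h k).
    by near: t; apply: (@cvg_line _ _ x (h k)); exact: open_nbhs_nbhs.
  by rewrite /dir_quotient !aE.
rewrite /dir_derive; case: xgetP => [l _ cl|/(_ _ cd)//].
exact: (cvg_unique (@norm_hausdorff _ V) cl cd).
Unshelve. all: by end_near. Qed.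

Lemma smooth_implicit : smooth_on U' psi.
Proof.
move=> k; have [a ta aE] := nderive_implicit k.
(* The padding [v] first appears at index [k], so differentiating the term along entry [k] is
   differentiating along [v]. For continuity the padding is [0]. *)
pose ext (h : 'I_k -> F) (v : F) (m : nat) := if insub m is Some i then h i else v.
have extE h v : (fun i : 'I_k => ext h v i) = h.
  by apply/funext => i; rewrite /ext valK.
split=> [x h v Ux|].
  have [a' ta' a'E] := implicit_term_derive ta k.
  exists (a' x (ext h v)).2.
  have := a'E x (ext h v) Ux.
  rewrite {1}/ext insubN ?ltnn// => ca.
  have ca' : (fun z : F * V => z.2)
      (t^-1 *: (a (x + t *: v) (ext h v) - a x (ext h v))) @[t --> 0^']
    --> (a' x (ext h v)).2.
    by apply: (cvg_comp _ _ ca); exact: cvg_snd.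
  apply: cvg_trans ca'; apply: near_eq_cvg; near=> t.
  have Ut : U' (x + t *: v).
    by near: t; apply: (@cvg_line _ _ x v); exact: open_nbhs_nbhs.
  by rewrite /dir_quotient -(extE h v) !aE ?extE.
have oUT : open (U' `*` [set: {ptws 'I_k -> F}]).
  rewrite openE => -[x h] [/= Ux _]; exists (U', setT) => //.
  by split => /=; [exact: open_nbhs_nbhs|exact: filterT].
rewrite continuous_open_subspace// => -[x h]; rewrite inE => -[/= Ux _].
have cx : z.1 @[z --> (x, h : {ptws 'I_k -> F})] --> x by exact: cvg_fst.
have ch i : z.2 i @[z --> (x, h : {ptws 'I_k -> F})] --> h i.
  have c2 : z.2 @[z --> (x, h : {ptws 'I_k -> F})] --> (h : {ptws 'I_k -> F}).
    exact: cvg_snd.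
  exact: (cvg_comp _ _ c2 (@proj_continuous _ (fun=> F) i h)).
have ce m : ext z.2 0 m @[z --> (x, h : {ptws 'I_k -> F})] --> ext h 0 m.
  by rewrite /ext; case: insub => [i|]; [exact: ch|exact: cvg_cst].
have ca : a z.1 (ext z.2 0) @[z --> (x, h : {ptws 'I_k -> F})] --> a x (ext h 0).
  exact: (implicit_term_cvg ta _ Ux cx ce).
have ca' : (snd \o (fun z : F * {ptws 'I_k -> F} => a z.1 (ext z.2 0))) z
    @[z --> (x, h : {ptws 'I_k -> F})] --> (a x (ext h 0)).2.
  have cs : snd @ nbhs (a x (ext h 0)) --> (a x (ext h 0)).2 by exact: cvg_snd.
  exact: (cvg_comp _ _ ca cs).
have aEh : nderive psi x h = (a x (ext h 0)).2 by rewrite -aE// extE.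
rewrite /continuous_at /= aEh.
apply: cvg_trans ca'; apply: near_eq_cvg; near=> z.
rewrite -[X in nderive _ _ X](extE z.2 0) aE//.
by near: z; apply: cx; exact: open_nbhs_nbhs.
Unshelve. all: by end_near. Qed.

End ImplicitSmooth.

(** * The partial derivative along the Banach factor *)

(** A nonzero [v] is rescaled to norm [d / 2], strictly inside the ball; hence the factor [2]. *)
Lemma homogeneous_bound (R : realType) (V W : normedModType R) (h : V -> W)
    (d c : R) : 0 < d -> (forall r v, h (r *: v) = r *: h v) ->
  (forall v, `|v| < d -> `|h v| <= c) -> forall v, `|h v| <= c * 2 / d * `|v|.
Proof.
move=> d0 hZ hc v; have [->|v0] := eqVneq v 0.
  by have := hZ 0 0; rewrite !scale0r => ->; rewrite !normr0 mulr0.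
have nv : 0 < `|v| by rewrite normr_gt0.
pose r := d / (2 * `|v|); have r0 : 0 < r by rewrite divr_gt0// mulr_gt0.
have := hc (r *: v); rewrite hZ (normrZ _ (h v)) (normrZ _ v) (gtr0_norm r0) => H.
rewrite -(ler_pM2l r0) (_ : r * (_ * _) = c); last first.
  by rewrite /r; field; rewrite !gt_eqF.
apply: H; rewrite /r invfM mulrA mulfVK ?gt_eqF//.
by rewrite ltr_pdivrMr// ltr_pMr// ltr1n.
Qed.

Section Partial.
Context (R : realType) (F : tvsType R) (V W : normedModType R).
Context (U : set (F * V)) (phi : F * V -> W).
Hypothesis oU : open U.
Hypothesis smoothphi : smooth_on U phi.

Definition partial2 (z : F * V) (v : V) : W :=
  nderive phi z (fun _ : 'I_1 => (0, v)).

Lemma partial2_linear z : U z -> linear (partial2 z).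
Proof.
move=> Uz r u v; apply: (nderive_linear oU smoothphi (i := ord0)) => //.
  by move=> j; rewrite ord1 eqxx.
by congr (_, _); rewrite /= scaler0 addr0.
Qed.

Lemma partial2_dir z v : U z ->
  dir_quotient phi z (0, v) t @[t --> 0^'] --> partial2 z v.
Proof.
move=> Uz; have := nderive_dir smoothphi (k := 0) (a := fun _ => 0) (v := (0, v)) Uz.
rewrite (_ : snoc _ _ = fun=> (0, v))//.
apply/funext => i; rewrite (_ : i = ord_max) ?snoc_max//.
by rewrite ord1; exact: val_inj.
Qed.

Lemma partial2_bounded z : U z -> exists M, forall v, `|partial2 z v| <= M * `|v|.
Proof.
move=> Uz; have lin := partial2_linear Uz.
have p0 : partial2 z 0 = 0.
  by apply: (nderive_eq0 oU smoothphi (i := ord0)).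
have cv : partial2 z v @[v --> (0 : V)] --> 0.
  rewrite -[X in _ --> nbhs X]p0; apply: (nderive_cvg oU smoothphi) => //.
    exact: cvg_cst.
  by move=> _; apply: cvg_pair; [exact: cvg_cst|exact: cvg_id].
have : \forall v \near (0 : V), `|partial2 z v| <= 1.
  exact: (cvgr0_norm_le _ cv _ ltr01).
move=> /nbhs_ballP[d /= d0 dP].
exists (1 * 2 / d) => v; apply: homogeneous_bound => // [r u|u ud].
  by have := lin r u 0; rewrite p0 !addr0.
by apply: dP; rewrite -ball_normE /= sub0r normrN.
Qed.

(* The second derivative is bilinear and jointly continuous, hence bounded near
   [(z0, 0, 0)]; this makes the first derivative locally Lipschitz in operator
   norm. *)
Lemma partial2_near z0 (e : R) : U z0 -> 0 < e ->
  \forall z \near z0, U z /\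
    forall v, `|partial2 z v - partial2 z0 v| <= e * `|v|.
Proof.
move=> Uz0 e0; set E := (F * V)%type.
pose D2 z v (b : E) := nderive phi z (snoc (fun _ : 'I_1 => (0 : F, v)) b).
(* A parameter is a step size, a direction in [E] and a vector in [V]. A neighbourhood [B1] of [0]
   among the directions takes the place of a norm on [E]. *)
pose P := (R^o * (E * V))%type.
pose p0 : P := (0, (0, 0)).
have c1 : p.1 @[p --> p0] --> (0 : R) by exact: cvg_fst.
have c2 : p.2 @[p --> p0] --> ((0, 0) : E * V) by exact: cvg_snd.
have c21 : (fst \o snd) p @[p --> p0] --> (0 : E).
  by apply: (cvg_comp _ _ c2); exact: cvg_fst.
have c22 : (snd \o snd) p @[p --> p0] --> (0 : V).
  by apply: (cvg_comp _ _ c2); exact: cvg_snd.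
have cz : (z0 + p.1 *: p.2.1) @[p --> p0] --> z0.
  have cz0 : z0 @[_ --> p0] --> z0 by exact: cvg_cst.
  by have := tvs_cvgD cz0 (tvs_cvgZ c1 c21); rewrite scale0r addr0; exact.
have cD : D2 (z0 + p.1 *: p.2.1) p.2.2 p.2.1 @[p --> p0] --> 0.
  have <- : D2 z0 0 0 = 0.
    by apply: (nderive_eq0 oU smoothphi (i := ord_max)) => //; rewrite snoc_max.
  apply: (nderive_cvg oU smoothphi) => // i.
  rewrite /snoc; case: unlift => [_|//].
  by apply: cvg_pair => //; exact: cvg_cst.
have nU : \forall p \near p0, U (z0 + p.1 *: p.2.1).
  by apply: cz; exact: open_nbhs_nbhs.
have nD : \forall p \near p0, `|D2 (z0 + p.1 *: p.2.1) p.2.2 p.2.1| <= 1.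
  exact: (cvgr0_norm_le _ cD _ ltr01).
have := filterI nU nD.
move=> [[A1 A2]/= [[d /= d0 dA] [[B1 B2]/= [B10 B20] B12]] AB].
have /nbhs_ballP[d' /= d'0 dB] := B20.
(* For [z] near [z0], [z - z0] is [tau *: b] with [b] in [B1]. The bound [tau < d] keeps the segment
   in range, and [tau * 2 / d' <= e] gives the final constant. *)
pose tau := Num.min (d / 2) (e * d' / 2).
have tau0 : 0 < tau by rewrite lt_min !divr_gt0// mulr_gt0.
have taud : tau < d.
  by rewrite gt_min ltr_pdivrMr// ltr_pMr// ltr1n.
have cb : tau^-1 *: (z - z0) @[z --> z0] --> (0 : E).
  have cz0 : z0 @[_ --> z0] --> z0 by exact: cvg_cst.
  have ct : tau^-1 @[_ --> z0] --> tau^-1 by exact: cvg_cst.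
  have ci : z @[z --> z0] --> z0 by exact: cvg_id.
  by have := tvs_cvgZ ct (tvs_cvgD ci (tvs_cvgN cz0)); rewrite subrr scaler0; exact.
near=> z.
have B1b : B1 (tau^-1 *: (z - z0)) by near: z; exact: cb.
pose b := tau^-1 *: (z - z0).
have zE : z - z0 = tau *: b by rewrite /b scalerA mulfV ?gt_eqF// scale1r.
have line s v : 0 <= s <= 1 -> `|v| < d' ->
    U (z0 + s *: (z - z0)) /\ `|D2 (z0 + s *: (z - z0)) v b| <= 1.
  move=> /andP[s0 s1] vd; rewrite zE scalerA.
  apply: (AB (s * tau, (b, v))); split => /=.
    apply: dA; rewrite /= sub0r normrN ger0_norm ?mulr_ge0// ?ltW//.
    by rewrite (le_lt_trans _ taud)// ler_piMl// ltW.
  by apply: B12; split => //=; apply: dB; rewrite -ball_normE /= sub0r normrN.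
have Uline s : 0 <= s <= 1 -> U (z0 + s *: (z - z0)).
  by move=> s01; have [] := line s 0 s01; rewrite ?normr0.
split.
  by have := Uline 1; rewrite scale1r addrC subrK; apply; rewrite ler01 lexx.
move=> v; have := @mean_value_line _ _ _ (fun y => partial2 y v)
  (fun s => D2 (z0 + s *: (z - z0)) v (z - z0)) z0 (z - z0) 0 (e * `|v|).
rewrite subr0 [z0 + _]addrC subrK; apply => s s01.
  exact: (nderive_dir smoothphi (Uline s s01)).
rewrite subr0; set y := z0 + _; have Uy : U y := Uline s s01.
have -> : D2 y v (z - z0) = tau *: D2 y v b.
  apply: (nderive_scale oU smoothphi (i := ord_max)) => //.
    by move=> j; rewrite /snoc; case: unliftP => // ->; rewrite eqxx.
  by rewrite !snoc_max.
have := @homogeneous_bound _ _ _ (fun v => D2 y v b) d' 1 d'0.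
move=> /(_ _ (fun v vd => (line s v s01 vd).2) v) H.
rewrite normrZ gtr0_norm// (@le_trans _ _ (tau * (1 * 2 / d' * `|v|)))//.
  rewrite ler_pM2l//; apply: H => r u.
  apply: (nderive_scale oU smoothphi (i := ord0)) => //.
    by move=> j; rewrite /snoc; case: unliftP => // i ->; rewrite ord1 -val_eqE.
  rewrite (_ : ord0 = widen_ord (leqnSn 1) ord0) ?snoc_widen; last exact: val_inj.
  by congr (_, _); rewrite /= scaler0.
rewrite mulrA ler_wpM2r// mul1r mulrA ler_pdivrMr//.
by rewrite -ler_pdivlMr// ge_min lexx orbT.
Unshelve. all: by end_near. Qed.

End Partial.

(** * Construction of the implicit function and its tameness *)

Lemma seminorm_ge0 (R : realType) (E : lmodType R) (p : E -> R) x :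
  is_seminorm p -> 0 <= p x.
Proof.
move=> [pD pZ]; have := pD x (-1 *: x).
rewrite pZ normrN normr1 mul1r scaleN1r subrr.
have -> : p 0 = 0 by have := pZ 0 0; rewrite scale0r normr0 mul0r.
lra.
Qed.

Theorem theorem4p2 (R : realType) (F : tvsType R) (p : nat -> F -> R)
    (V W : completeNormedModType R) (U : set (F * V)) (phi : F * V -> W)
    (x0 : F) (y0 : V) :
  tame_frechet p ->
  tvs_isomorphic V W ->
  open U ->
  smooth_tame_on (prod_grading p (@norm_grading R V)) (@norm_grading R W)
    U phi ->
  U (x0, y0) ->
  phi (x0, y0) = 0 ->
  bijective (dir_derive (fun y : V => phi (x0, y)) y0) ->
  exists (U' : set F) (U'' : set V) (psi : F -> V),
    [/\ open U' /\ U' x0, open U'' /\ U'' y0, U' `*` U'' `<=` U,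
        forall x, U' x -> U'' (psi x) &
        smooth_tame_on p (@norm_grading R V) U' psi /\
        forall x y, U' x -> U'' y -> (phi (x, y) = 0 <-> y = psi x)].

Proof.
move=> tF _ oU [sphi _] Uz0 phi00 bij.
set z0 := (x0, y0) in Uz0 phi00.
have AE : dir_derive (fun y : V => phi (x0, y)) y0 = partial2 phi z0.
  apply/funext => v.
  have cd : dir_quotient (fun y : V => phi (x0, y)) y0 v t @[t --> 0^'] -->
      partial2 phi z0 v.
    apply: cvg_trans (partial2_dir sphi (v := v) Uz0).
    apply: near_eq_cvg; apply: nearW => t.
    rewrite /dir_quotient; congr (_ *: (phi _ - _)).
    by congr (_, _); rewrite /= scaler0 addr0.
  rewrite /dir_derive; case: xgetP => [l _ cl|/(_ _ cd)//].
  exact: (cvg_unique (@norm_hausdorff _ W) cl cd).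
have [Ai AK_ KA] : bijective (partial2 phi z0) by rewrite -AE.
pose A : {linear V -> W} := HB.pack (partial2 phi z0)
  (GRing.isLinear.Build _ _ _ _ _ (partial2_linear oU sphi Uz0)).
have [M AM] := partial2_bounded oU sphi Uz0.
have [K K0 AK] := @bounded_inverse _ _ _ A Ai M AM KA (can_inj AK_).
have K20 : 0 < 2 * K by rewrite mulr_gt0.
(* With this tolerance the deviation from [A] is at most half of the lower bound [1 / K] for [A], as
   the contraction argument requires. *)
have e0 : 0 < (2 * K)^-1 by rewrite invr_gt0.
have [[N1 N2] /= [n1 n2] N12] := partial2_near oU sphi Uz0 e0.
have /nbhs_ballP[r /= r0 rN2] := n2.
pose V0 := ball y0 r.
have NV x y : N1 x -> V0 y -> U (x, y) /\
    forall v, `|partial2 phi (x, y) v - A v| <= (2 * K)^-1 * `|v|.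
  by move=> Nx Vy; apply: (N12 (x, y)); split => //=; exact: rN2.
(* The mean value inequality on the vertical segment from [(x, y')] to [(x, y)]; its second
   coordinate stays in [V0] because balls are convex. *)
have fA x y y' : N1 x -> V0 y -> V0 y' ->
    `|phi (x, y) - phi (x, y') - A (y - y')| <= (2 * K)^-1 * `|y - y'|.
  move=> Nx Vy Vy'.
  have zs s : (x, y') + s *: (0, y - y') = (x, y' + s *: (y - y')).
    by congr (_, _); rewrite /= scaler0 addr0.
  have Vs s : 0 <= s <= 1 -> V0 (y' + s *: (y - y')).
    move=> /andP[s0 s1]; move: Vy Vy'; rewrite /V0 -ball_normE /= => Vy Vy'.
    rewrite (_ : _ - _ = (1 - s) *: (y0 - y') + s *: (y0 - y)); last first.
      rewrite scalerBl scale1r -[RHS]addrA [- _ + _]addrC -scalerBr opprB.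
      by rewrite [y0 - y + _]addrC subrKA opprD addrA -scalerN opprB.
    rewrite (le_lt_trans (ler_normD _ _))// !normrZ !ger0_norm ?subr_ge0//.
    move: (`|y0 - y'|) (`|y0 - y|) Vy' Vy => a b ar br.
    have [am bm] : a <= Num.max a b /\ b <= Num.max a b.
      by rewrite !le_max !lexx orbT.
    have mr : Num.max a b < r by rewrite gt_max ar.
    by nra.
  have := @mean_value_line _ _ _ phi
    (fun s => partial2 phi ((x, y') + s *: (0, y - y')) (y - y'))
    (x, y') (0, y - y') (A (y - y')) ((2 * K)^-1 * `|y - y'|).
  have -> : (x, y') + (0, y - y') = (x, y).
    by congr (_, _); rewrite /= ?addr0// addrC subrK.
  apply=> s s01; rewrite zs; have [Us Bs] := NV _ _ Nx (Vs s s01).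
    exact: partial2_dir.
  exact: Bs.
have cphi : phi (x, y0) @[x --> x0] --> 0.
  rewrite -phi00; pose a (i : 'I_0) : F * V := 0.
  have := @nderive_cvg _ _ _ U phi oU sphi _ (nbhs x0) _ 0%N (fun x => (x, y0))
    (fun _ => a) z0 a Uz0.
  by apply => //; [apply: cvg_pair; [exact: cvg_id|exact: cvg_cst]|case].
(* The closed ball of radius [rho] about [y0] lies in the open ball [V0]; roots are found in the
   former and are unique in the latter. *)
pose rho := r / 2.
have rho0 : 0 < rho by rewrite divr_gt0.
have rhor : rho < r by rewrite ltr_pdivrMr// ltr_pMr// ltr1n.
have rhoV y : `|y - y0| <= rho -> V0 y.
  by move=> yr; rewrite /V0 -ball_normE /= distrC (le_lt_trans yr).
(* The second condition is the smallness at the centre under which [perturbed_root] applies; taking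
   the interior makes [U'] open. *)
pose U' := interior [set x | N1 x /\ `|phi (x, y0)| <= rho / (2 * K)].
have U'x0 : U' x0.
  rewrite /U' /interior /=; apply: filterI => //.
  by apply: (cvgr0_norm_le _ cphi); rewrite divr_gt0.
have U'N x : U' x -> N1 x /\ `|phi (x, y0)| <= rho / (2 * K).
  by move=> /interior_subset.
have /choice[psi psiP] : forall x, exists y, U' x ->
    `|y - y0| <= rho /\ phi (x, y) = 0.
  move=> x; have [/U'N[Nx px]|] := pselect (U' x); last by exists y0.
  have [y yr y0E] := @perturbed_root _ _ _ A Ai K K0 AK KA
    (fun y => phi (x, y)) y0 rho (ltW rho0)
    (fun y y' yr y'r => fA x y y' Nx (rhoV y yr) (rhoV y' y'r)) px.
  by exists y.
have psiV x : U' x -> V0 (psi x) by move=> /psiP[/rhoV].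
have psi_lip x y : U' x -> V0 y -> `|y - psi x| <= 2 * K * `|phi (x, y)|.
  move=> Ux Vy; have := perturbed_injective (f := fun y => phi (x, y)) K0 AK
    (fA x y (psi x) (U'N x Ux).1 Vy (psiV x Ux)).
  by rewrite (psiP x Ux).2 subr0.
have B_lip x v : U' x -> `|v| <= 2 * K * `|partial2 phi (x, psi x) v|.
  move=> Ux; have [Uz Bz] := NV x _ (U'N x Ux).1 (psiV x Ux).
  have := @perturbed_injective _ _ _ A K K0 AK (partial2 phi (x, psi x)) v 0.
  have -> : partial2 phi (x, psi x) 0 = 0.
    by apply: (nderive_eq0 oU sphi (i := ord0)).
  by rewrite !subr0; apply; exact: Bz.
(* Along the graph the partial derivative is a small perturbation of [A]. A preimage of [w] is a
   root, in the ball of radius [2 * K * |w|], of the derivative minus [w], whose value at the centre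
   has norm exactly [|w|]. *)
have /choice[L0 L0P] : forall q : F * W, exists v, U' q.1 ->
    partial2 phi (q.1, psi q.1) v = q.2.
  move=> [x w] /=; have [Ux|] := pselect (U' x); last by exists 0.
  have [Uz Bz] := NV x _ (U'N x Ux).1 (psiV x Ux).
  have lin := partial2_linear oU sphi Uz.
  have [|||y _ /eqP] := @perturbed_root _ _ _ A Ai K K0 AK KA
    (fun v => partial2 phi (x, psi x) v - w) 0 (2 * K * `|w|).
  - by rewrite mulr_ge0// ltW.
  - move=> v v' _ _; rewrite opprB addrA subrK.
    have -> : partial2 phi (x, psi x) v - partial2 phi (x, psi x) v' =
        partial2 phi (x, psi x) (v - v').
      by rewrite -[in RHS]scaleN1r [v + _]addrC lin scaleN1r addrC.
    exact: Bz.
  - rewrite (_ : partial2 phi (x, psi x) 0 = 0) ?sub0r ?normrN.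
      by rewrite mulrAC mulfV ?gt_eqF// mul1r.
    by apply: (nderive_eq0 oU sphi (i := ord0)).
  by rewrite subr_eq0 => /eqP; exists y.
exists U', V0, psi; split.
- by split => //; exact: open_interior.
- by split; [exact: ball_open|exact: ballxx].
- by move=> [x y] [/= /U'N[Nx _] Vy]; exact: (NV x y Nx Vy).1.
- exact: psiV.
split; first split.
- apply: (@smooth_implicit _ F V W U phi U' V0 psi (2 * K) oU sphi
    (@open_interior _ _) (ball_open _ _) _ psiV (fun x Ux => (psiP x Ux).2) K20
    psi_lip B_lip (fun x w => L0 (x, w)) (fun x w => L0P (x, w))).
  by move=> [x y] [/= /U'N[Nx _] Vy]; exact: (NV x y Nx Vy).1.
(* The values of [psi] lie within [rho] of [y0] and every seminorm of [V] is its norm, so one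
   constant serves all [n], the summand [1] of the tame estimate being enough. *)
- exists 0%N, 0%N, (fun _ => `|y0| + rho) => [_|n _ x Ux].
    by rewrite ltr_wpDl.
  have pn : 0 <= p (n + 0)%N x.
    by apply: seminorm_ge0; exact: (grading_seminorm (tame_is_grading tF)).
  have : `|psi x| <= `|y0| + rho.
    rewrite -[psi x](subrK y0) addrC (le_trans (ler_normD _ _))// lerD//.
    exact: (psiP x Ux).1.
  rewrite /norm_grading => /le_trans; apply.
  by rewrite ler_peMr ?lerDl// addr_ge0// ltW.
move=> x y Ux Vy; split => [pxy|->]; last exact: (psiP x Ux).2.
apply/eqP; rewrite -subr_eq0 -normr_le0.
by rewrite (le_trans (psi_lip x y Ux Vy))// pxy normr0 mulr0.
Qed.
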